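(* Let $\Bbbk$ be a field of characteristic $0$, let $\Delta$ be a simplicial complex on $n$ vertices, and let $A=A(\Delta)=\Bbbk[x_1,\ldots,x_n]/\langle x_1^2,\ldots,x_n^2,I_\Delta\rangle$, where $I_\Delta$ is the Stanley-Reisner ideal of $\Delta$. Suppose that $A$ has the Weak Lefschetz Property (WLP) in degree $1$. If $\dim_\Bbbk A_2\le\dim_\Bbbk A_1$, then the top socle degree of $A$ is at most $3$.
   Context: A simplicial complex $\Delta$ on a finite non-empty vertex set $V=\{1,\ldots,n\}$ is a non-empty collection of subsets (faces) of $V$ closed under taking subsets. The Stanley-Reisner ideal is $I_\Delta=\langle x_{i_1}\cdots x_{i_m} : \{i_1,\ldots,i_m\}\notin\Delta\rangle$. The algebra $A(\Delta)$ is standard graded Artinian; $A_i$ is its degree-$i$ component. The top socle degree of $A$ is the highest degree of a nonzero monomial of $A$, i.e. the largest $j$ with $A_j\neq0$. WLP holds for $A$ in degree $i$ if, for a general linear form $\ell$, the multiplication map $\times\ell: A_i\to A_{i+1}$ is injective or surjective. *)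

(* Defs.v *)
From HB Require Import structures.
From mathcomp Require Import all_boot all_algebra ring_quotient.
From mathcomp.classical Require boolp.
From mathcomp Require Import mpoly.

Set Implicit Arguments.
Unset Strict Implicit.
Unset Printing Implicit Defensive.

Import GRing.Theory.
Local Open Scope ring_scope.
Local Open Scope quotient_scope.

(* Vertices are indexed from 0; a vertex i with [set i] \notin D is allowed. *)
Record simplicial_complex (n : nat) := SimplicialComplex {
  faces :> {set {set 'I_n}};
  faces_neq0 : faces != set0;
  faces_closed : forall F G : {set 'I_n},
    F \in faces -> G \subset F -> G \in faces }.

Definition ideal_gen (R : comNzRingType) (G : R -> Prop) (p : R) : Prop :=
  exists s : seq (R * R),
    (forall u, u \in s -> G u.2) /\ p = \sum_(u <- s) u.1 * u.2.

Section IdealGen.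
Variables (R : comNzRingType) (G : R -> Prop).

Lemma ideal_gen_gen g : G g -> ideal_gen G g.
Proof.
move=> Gg; exists [:: (1, g)]; rewrite big_seq1 mul1r; split=> // u.
by rewrite inE => /eqP->.
Qed.

Lemma ideal_gen0 : ideal_gen G 0.
Proof. by exists [::]; rewrite big_nil. Qed.

Lemma ideal_genD p q : ideal_gen G p -> ideal_gen G q -> ideal_gen G (p + q).
Proof.
move=> [s [sG ->]] [t [tG ->]]; exists (s ++ t); rewrite big_cat; split=> // u.
by rewrite mem_cat => /orP[/sG|/tG].
Qed.

Lemma ideal_genM a p : ideal_gen G p -> ideal_gen G (a * p).
Proof.
move=> [s [sG ->]]; exists [seq (a * u.1, u.2) | u <- s]; split.
  by move=> u /mapP[v /sG Gv ->].
by rewrite big_map mulr_sumr; apply: eq_bigr => u _; rewrite mulrA.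
Qed.

Lemma ideal_gen_sum (I : Type) (r : seq I) (P : pred I) (F : I -> R) :
  (forall i, P i -> ideal_gen G (F i)) -> ideal_gen G (\sum_(i <- r | P i) F i).
Proof.
by move=> FG; apply: big_ind => //; [exact: ideal_gen0|exact: ideal_genD].
Qed.

Lemma ideal_gen_min (Z : R -> Prop) :
    Z 0 -> (forall p q, Z p -> Z q -> Z (p + q)) ->
    (forall a p, Z p -> Z (a * p)) -> (forall g, G g -> Z g) ->
  forall p, ideal_gen G p -> Z p.
Proof.
move=> Z0 ZD ZM ZG p [s [sG ->]]; rewrite big_seq.
by apply: big_ind => // u /sG Gu; apply/ZM/ZG.
Qed.

End IdealGen.

Section Ideals.
Variables (k : fieldType) (n : nat) (D : simplicial_complex n).

Definition stanley_reisner_ideal : {mpoly k[n]} -> Prop :=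
  ideal_gen (fun p => exists2 F : {set 'I_n},
                        F \notin D & p = \prod_(i in F) 'X_i).

Definition defining_ideal : {mpoly k[n]} -> Prop :=
  ideal_gen (fun p => (exists i : 'I_n, p = 'X_i ^+ 2)
                      \/ stanley_reisner_ideal p).

(* [{ideal_quot _}] expects a boolean predicate. *)
Definition defining_pred : {pred {mpoly k[n]}} :=
  fun p => boolp.asbool (defining_ideal p).

Lemma defining_predE p : (p \in defining_pred) <-> defining_ideal p.
Proof. by split=> /boolp.asboolP. Qed.

Definition mnm_of_set (F : {set 'I_n}) : 'X_{1..n} :=
  [multinom nat_of_bool (i \in F) | i < n].

Lemma mnm_of_set_inj : injective mnm_of_set.
Proof.
move=> F G /mnmP eFG; apply/setP => i.
by have := eFG i; rewrite !mnmE; case: (i \in F); case: (i \in G).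
Qed.

Lemma prod_mnm_of_set (F : {set 'I_n}) :
  \prod_(i in F) 'X_i = 'X_[mnm_of_set F] :> {mpoly k[n]}.
Proof.
rewrite [RHS]mpolyXE_id big_mkcond; apply: eq_bigr => i _.
by rewrite mnmE; case: (i \in F); rewrite ?expr1 ?expr0.
Qed.

Lemma set0_face : set0 \in (D : {set _}).
Proof.
by have /set0Pn[F DF] := faces_neq0 D; exact: faces_closed DF (sub0set _).
Qed.

Lemma face_coeff0 p (F : {set 'I_n}) :
  defining_ideal p -> F \in (D : {set _}) -> p@_(mnm_of_set F) = 0.
Proof.
move=> Ip; move: F.
pose Z (q : {mpoly k[n]}) :=
  forall F, F \in (D : {set _}) -> q@_(mnm_of_set F) = 0.
rewrite -/(Z p).
have Z0 : Z 0 by move=> F _; rewrite mcoeff0.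
have ZD q r : Z q -> Z r -> Z (q + r).
  by move=> Zq Zr F DF; rewrite mcoeffD Zq ?Zr ?addr0.
have ZX m : (forall F, F \in (D : {set _}) -> ~~ (m <= mnm_of_set F)%MM) ->
    forall a, Z (a * 'X_[m]).
  move=> mF a F /mF nle; rewrite mcoeffM; apply: big1 => -[m1 m2] /= /eqP e.
  rewrite mcoeffX; case: eqP => [e2|]; last by rewrite mulr0.
  by case/negP: nle; rewrite e e2; apply: lem_addl.
have ZM a q : Z q -> Z (a * q).
  move=> Zq F DF; rewrite mcoeffM; apply: big1 => -[m1 m2] /= /eqP e.
  pose G := [set i | 0 < m2 i]%N.
  have le1 i : (m1 i + m2 i = (i \in F))%N.
    by move/mnmP/(_ i): e; rewrite mnmE mnmDE.
  have -> : (m2 : 'X_{1..n}) = mnm_of_set G.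
    apply/mnmP => i; rewrite mnmE inE; have := le1 i.
    by case: (m2 i) => [|[|x]] //; case: (i \in F) => //; rewrite !addnS.
  rewrite Zq ?mulr0 //; apply: faces_closed DF _; apply/subsetP => i.
  rewrite inE => m2i; have := le1 i; case: (i \in F) => //.
  by case: (m2 i) m2i => // x; rewrite addnS.
apply: ideal_gen_min Ip => // q [[i ->]|].
  rewrite mpolyXn -['X_[_]]mul1r; apply: ZX => F _.
  apply/negP => /mnm_lepP/(_ i); rewrite mulmnE !mnmE eqxx.
  by case: (i \in F).
apply: ideal_gen_min => // _ [F nDF ->].
rewrite prod_mnm_of_set -['X_[_]]mul1r; apply: ZX => G DG; apply/negP => le.
case/negP: nDF; apply: faces_closed DG _; apply/subsetP => i Fi.
by move/mnm_lepP/(_ i): le; rewrite !mnmE Fi; case: (i \in G).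
Qed.

Lemma defining_idealX m :
    (forall F, F \in (D : {set _}) -> m != mnm_of_set F) ->
  defining_ideal 'X_[m].
Proof.
move=> mF; pose F := [set i | 0 < m i]%N.
have [[i m2]|m1] := boolp.pselect (exists i, 1 < m i)%N.
  have le2 : (U_(i) *+ 2 <= m)%MM.
    apply/mnm_lepP => j; rewrite mulmnE mnmE.
    by case: eqP => [<-|] //.
  rewrite -(submK le2) mpolyXD; apply: ideal_genM; apply: ideal_gen_gen.
  by left; exists i; rewrite -mpolyXn.
have em : m = mnm_of_set F.
  apply/mnmP => i; rewrite mnmE inE.
  case e: (m i) => [|[|x]] //.
  by case: m1; exists i; rewrite e.
apply: ideal_gen_gen; right; apply: ideal_gen_gen; exists F.
  by apply/negP => /mF; rewrite -em eqxx.
by rewrite prod_mnm_of_set -em.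
Qed.

Lemma defining_pred_idealr : idealr_closed defining_pred.
Proof.
split.
- by apply/defining_predE/ideal_gen0.
- apply/negP => /defining_predE/face_coeff0/(_ set0_face).
  rewrite mcoeff1 (_ : mnm_of_set set0 = 0%MM) ?eqxx; last first.
    by apply/mnmP => i; rewrite !mnmE inE.
  by move/eqP; rewrite oner_eq0.
- move=> a p q /defining_predE Ip /defining_predE Iq; apply/defining_predE.
  by apply: ideal_genD => //; apply: ideal_genM.
Qed.

HB.instance Definition _ :=
  isIdealr.Build {mpoly k[n]} defining_pred defining_pred_idealr.

Definition SRalgebra : Type := {ideal_quot defining_pred}.

HB.instance Definition _ := GRing.ComNzRing.on SRalgebra.

Definition SRproj (p : {mpoly k[n]}) : SRalgebra :=
  \pi_({ideal_quot defining_pred}) p.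

Lemma SRproj_zmod_morphism : zmod_morphism SRproj.
Proof. exact: (rmorphB (\pi_({ideal_quot defining_pred}))). Qed.

Lemma SRproj_monoid_morphism : monoid_morphism SRproj.
Proof.
split; first exact: (rmorph1 (\pi_({ideal_quot defining_pred}))).
exact: (rmorphM (\pi_({ideal_quot defining_pred}))).
Qed.

HB.instance Definition _ :=
  GRing.isZmodMorphism.Build {mpoly k[n]} SRalgebra SRproj SRproj_zmod_morphism.
HB.instance Definition _ :=
  GRing.isMonoidMorphism.Build {mpoly k[n]} SRalgebra SRproj
    SRproj_monoid_morphism.

Definition SRrepr (a : SRalgebra) : {mpoly k[n]} :=
  repr (a : {ideal_quot defining_pred}).

Lemma SRreprK : cancel SRrepr SRproj.
Proof. exact: (@reprK _ {ideal_quot defining_pred}). Qed.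

Lemma SRproj_eqP p q : SRproj p = SRproj q <-> defining_ideal (p - q).
Proof.
split=> [/eqmodP|h]; first by rewrite /= Quotient.equivE => /defining_predE.
by apply/eqmodP; rewrite /= Quotient.equivE; apply/defining_predE.
Qed.

Lemma SRproj_eq0P p : SRproj p = 0 <-> defining_ideal p.
Proof. by rewrite -(rmorph0 SRproj) SRproj_eqP subr0. Qed.

Definition SRscale (c : k) (a : SRalgebra) : SRalgebra := SRproj c%:MP * a.

Fact SRscaleA c d a : SRscale c (SRscale d a) = SRscale (c * d) a.
Proof. by rewrite /SRscale mulrA -rmorphM -mpolyCM. Qed.
Fact SRscale1 : left_id 1 SRscale.
Proof. by move=> a; rewrite /SRscale rmorph1 mul1r. Qed.
Fact SRscaleDr : right_distributive SRscale +%R.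
Proof. by move=> c a b; rewrite /SRscale mulrDr. Qed.
Fact SRscaleDl a : {morph SRscale^~ a : c d / c + d}.
Proof. by move=> c d; rewrite /SRscale mpolyCD rmorphD mulrDl. Qed.
HB.instance Definition _ := GRing.Zmodule_isLmodule.Build k SRalgebra
  SRscaleA SRscale1 SRscaleDr SRscaleDl.

Fact SRscaleAl (c : k) (a b : SRalgebra) : c *: (a * b) = c *: a * b.
Proof. exact: mulrA. Qed.
HB.instance Definition _ := GRing.Lmodule_isLalgebra.Build k SRalgebra SRscaleAl.
HB.instance Definition _ := GRing.Lalgebra_isComAlgebra.Build k SRalgebra.

Fact SRproj_scalable : scalable SRproj.
Proof. by move=> c p; rewrite -mul_mpolyC rmorphM. Qed.
HB.instance Definition _ :=
  GRing.isScalable.Build k {mpoly k[n]} SRalgebra *:%R SRproj SRproj_scalable.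

(* The squarefree monomials supported on faces form a k-basis. *)
Definition SRmon (i : 'I_#|D|) : 'X_{1..n} := mnm_of_set (enum_val i).

Definition SRcoord (a : SRalgebra) : 'rV[k]_#|D| :=
  \row_i (SRrepr a)@_(SRmon i).

Lemma SRcoordE p i : SRcoord (SRproj p) 0 i = p@_(SRmon i).
Proof.
rewrite mxE; apply/eqP; rewrite -subr_eq0 -mcoeffB; apply/eqP.
apply: face_coeff0 (enum_valP i); apply/SRproj_eqP; exact: SRreprK.
Qed.

Definition SRcomb (v : 'rV[k]_#|D|) : SRalgebra :=
  SRproj (\sum_i v 0 i *: 'X_[SRmon i]).

Lemma SRmon_inj : injective SRmon.
Proof. by move=> i j /mnm_of_set_inj/enum_val_inj. Qed.

Lemma SRcomb_coeff (v : 'rV[k]_#|D|) j :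
  (\sum_i v 0 i *: 'X_[SRmon i])@_(SRmon j) = v 0 j.
Proof.
rewrite raddf_sum /= (bigD1 j) //= mcoeffZ mcoeffX eqxx mulr1 big1 ?addr0 //.
by move=> i ij; rewrite mcoeffZ mcoeffX (inj_eq SRmon_inj) (negPf ij) mulr0.
Qed.

Lemma SRcombK : cancel SRcomb SRcoord.
Proof. by move=> v; apply/rowP => j; rewrite SRcoordE SRcomb_coeff. Qed.

Lemma SRcoordK : cancel SRcoord SRcomb.
Proof.
move=> a; rewrite -[RHS]SRreprK -[a in LHS]SRreprK; move: (SRrepr a) => p.
apply/SRproj_eqP; set q := _ - p.
have q0 i : q@_(SRmon i) = 0.
  by rewrite mcoeffB SRcomb_coeff SRcoordE subrr.
rewrite [q]mpolyE; apply: ideal_gen_sum => m _.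
have [[i ->]|mF] := boolp.pselect (exists i, m = SRmon i).
  by rewrite q0 scale0r; apply: ideal_gen0.
rewrite -mul_mpolyC; apply: ideal_genM; apply: defining_idealX => F DF.
apply/eqP => e; apply: mF; exists (enum_rank_in DF F).
by rewrite /SRmon enum_rankK_in.
Qed.

Fact SRalgebra_vector : Vector.axiom #|D| SRalgebra.
Proof.
exists SRcoord; last by exists SRcomb; [exact: SRcoordK|exact: SRcombK].
move=> c a b; rewrite -[a in LHS]SRreprK -[b in LHS]SRreprK.
rewrite -linearZ -linearD; apply/rowP => i.
by rewrite SRcoordE mcoeffD mcoeffZ !mxE.
Qed.
HB.instance Definition _ :=
  Lmodule_hasFinDim.Build k SRalgebra SRalgebra_vector.

(* A_i: the image of the homogeneous polynomials of degree i, see SRgradeP. *)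
Definition SRgrade (i : nat) : {vspace SRalgebra} :=
  <<[seq SRproj 'X_[val m] | m <- enum {: 'X_{1..n < i.+1}} & mdeg (val m) == i]>>.

Lemma SRgradeP i a :
  reflect (exists2 p : {mpoly k[n]}, p \is i.-homog & a = SRproj p)
          (a \in SRgrade i).
Proof.
apply: (iffP idP) => [|[p /dhomogP hp ->]].
  move/(@coord_span _ _ _ (in_tuple _)) ->.
  set s := in_tuple _; set t := map _ _ in s *.
  suff hs (j : 'I_(size t)) : exists2 p : {mpoly k[n]}, p \is i.-homog & t`_j = SRproj p.
    elim/big_ind: _ => [|_ _ [p hp ->] [q hq ->]|j _].
    - by exists 0; rewrite ?rmorph0 ?dhomog0.
    - by exists (p + q); rewrite ?rmorphD ?rpredD.
    - have [p hp ep] := hs j.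
      by exists (coord s j a *: p); [rewrite rpredZ | rewrite linearZ /= ep].
  have /mapP[m] : t`_j \in t by rewrite mem_nth.
  by rewrite mem_filter => /andP[dm _] ->; exists 'X_[val m]; rewrite ?dhomogX.
rewrite [p]mpolyE linear_sum big_seq /=; apply: memv_suml => m /hp dm.
rewrite linearZ; apply: memvZ; apply: memv_span.
have lt_m : (mdeg m < i.+1)%N by rewrite dm.
apply/mapP; exists (BMultinom lt_m); last by [].
by rewrite mem_filter mem_enum /= dm eqxx.
Qed.

Lemma SRgrade0_neq0 : SRgrade 0 != 0%VS.
Proof.
apply/negP => /eqP e; have : (1 : SRalgebra) \in SRgrade 0.
  by apply/SRgradeP; exists 1; rewrite ?dhomog1 ?rmorph1.
by rewrite e memv0 oner_eq0.
Qed.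

Lemma SRgrade_bound j : SRgrade j != 0%VS -> (j <= n)%N.
Proof.
apply: contraNT; rewrite -ltnNge => lt_nj; rewrite -subv0.
apply/subvP => a /SRgradeP[p /dhomogP hp ->]; rewrite memv0; apply/eqP.
apply/SRproj_eq0P; rewrite [p]mpolyE big_seq; apply: ideal_gen_sum => m /hp dm.
rewrite -mul_mpolyC; apply: ideal_genM; apply: defining_idealX => F _.
have {}dm : mdeg m = j := dm; apply/eqP => e; move: lt_nj.
apply/negP; rewrite -leqNgt -dm e mdegE.
rewrite -[X in (_ <= X)%N]card_ord -sum1_card leq_sum // => i _.
by rewrite mnmE; case: (i \in F).
Qed.

Definition top_socle_degree : nat :=
  ex_maxn (ex_intro (fun j => SRgrade j != 0%VS) 0%N SRgrade0_neq0) SRgrade_bound.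

Definition linear_form (c : 'I_n -> k) : SRalgebra :=
  \sum_(i < n) c i *: SRproj 'X_i.

(* "For a general linear form" means on a non-empty Zariski-open set of        *)
(* coefficient vectors c; over an infinite field every such set contains a     *)
(* principal one, {c | P(c) <> 0} with P a non-zero polynomial.                *)
Definition WLP_in_degree (i : nat) : Prop :=
  exists2 P : {mpoly k[n]}, P != 0 &
    forall c : 'I_n -> k, P.@[c] != 0 ->
      {in SRgrade i &, injective (fun a => linear_form c * a)} \/
      (forall b, b \in SRgrade i.+1 ->
         exists2 a, a \in SRgrade i & b = linear_form c * a).

End Ideals.

(* Main.v *)
Require Import Defs.
From mathcomp Require Import all_boot all_algebra.
From mathcomp Require Import ring mpoly.

(** A face of size at least 4 makes the 1-skeleton contain a 4-cycle. For
    l = sum_i c_i x_i, the coefficient of x_i x_j in l * a is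
    c_i a_j + c_j a_i, and on the edges of an even cycle these coefficients
    satisfy a linear relation (an alternating sum, weighted by the c_i), which
    is nontrivial if no c_i vanishes. So multiplication by a general l is
    not surjective onto A_2; by WLP it is then injective, and the hypothesis on
    dimensions makes it surjective after all. *)

Import GRing.Theory.

Section Nonvanishing.
Local Open Scope ring_scope.

(** Uniqueness of base-[d] expansions: reduction modulo [d] recovers the lowest digit, and induction
    handles the rest. *)
Lemma digits_inj (d n : nat) (f g : 'I_n -> nat) :
    (forall i, f i < d)%N -> (forall i, g i < d)%N ->
  (\sum_(i < n) f i * d ^ i = \sum_(i < n) g i * d ^ i)%N -> f =1 g.
Proof.
elim: n f g => [|n IHn] f g fd gd; first by move=> _ [].
have low h : (\sum_(i < n.+1) h i * d ^ i
              = (\sum_(i < n) h (lift ord0 i) * d ^ i) * d + h ord0)%N.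
  rewrite big_ord_recl expn0 muln1 addnC big_distrl; congr (_ + _)%N.
  by apply: eq_bigr => i _; rewrite /= -mulnA -expnSr.
rewrite !low => e.
have d_gt0 : (0 < d)%N by apply: leq_ltn_trans (fd ord0).
have e0 : f ord0 = g ord0.
  have := congr1 (modn^~ d) e; rewrite !modnMDl.
  by rewrite (modn_small (fd _)) (modn_small (gd _)).
move: e; rewrite e0 => /addIn/eqP; rewrite eqn_pmul2r // => /eqP e i.
by have [j ->|->] := unliftP ord0 i; first exact: (IHn _ _ _ _ e j).
Qed.

(** In characteristic 0 the images of 0, ..., [size p] - 1 are distinct, which is one element too
    many for all of them to be roots. *)
Lemma poly_nonroot (k : fieldType) (char0 : [pchar k] =i pred0)
  (p : {poly k}) : p != 0 -> exists x, p.[x] != 0.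
Proof.
move=> p0; have /allPn[x _ px] :
    ~~ all (root p) [seq i%:R | i <- iota 0 (size p)].
  apply/negP => pr; have := max_poly_roots p0 pr.
  rewrite size_map size_iota ltnn => /(_ _)/notF; apply.
  rewrite map_inj_uniq ?iota_uniq // => i j /eqP.
  have ch := (pcharf0P k).1 char0.
  wlog le_ij : i j / (i <= j)%N => [hw|].
    by case/orP: (leq_total i j) => /hw h // /eqP/esym/eqP/h.
  rewrite eq_sym -subr_eq0 -natrB // ch subn_eq0 => le_ji.
  by apply/eqP; rewrite eqn_leq le_ij.
by exists x.
Qed.

(* Kronecker's substitution of x^(d^i) for X_i, with d above all exponents,
   reduces to the univariate case. *)
Lemma mpoly_nonroot (k : fieldType) (char0 : [pchar k] =i pred0)
    (n : nat) (p : {mpoly k[n]}) :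
  p != 0 -> exists c : 'I_n -> k, p.@[c] != 0.
Proof.
move=> p0; pose d := msize p.
pose code (m : 'X_{1..n}) : nat := (\sum_(i < n) m i * d ^ i)%N.
pose q : {poly k} := \sum_(m <- msupp p) p@_m *: 'X^(code m).
have small m : m \in msupp p -> forall i, (m i < d)%N.
  move=> pm i; apply: leq_ltn_trans (msize_mdeg_lt pm).
  by rewrite mdegE (bigD1 i) //= leq_addr.
have q0 : q != 0.
  have pm := mlead_supp p0; apply: contraNneq p0 => q0.
  rewrite -mleadc_eq0; apply/eqP; transitivity q`_(code (mlead p)); last first.
    by rewrite q0 coef0.
  (* [code] is injective on the support of [p], so no other term of [q] can cancel the one coming
     from the leading monomial. *)
  rewrite coef_sum (bigD1_seq (mlead p)) ?msupp_uniq //=.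
  rewrite coefZ coefXn eqxx mulr1 big_seq_cond big1 ?addr0 //.
  move=> m /andP[pm' ne]; rewrite coefZ coefXn; case: eqP => [e|]; last first.
    by rewrite mulr0.
  case/eqP: ne; apply/mnmP => i; apply: esym.
  exact: (digits_inj _ _ _ _ (small _ pm) (small _ pm') e).
have [x qx] := poly_nonroot k char0 q q0.
exists (fun i => x ^+ (d ^ i)); apply: contraNneq qx => px.
rewrite /q horner_sum -[X in _ == X]px mevalE; apply/eqP/eq_bigr => m _.
rewrite hornerZ hornerXn /code expr_sum; congr (_ * _).
by apply: eq_bigr => i _; rewrite -exprM mulnC.
Qed.

End Nonvanishing.

Section SkeletonEdges.
Local Open Scope ring_scope.
Variables (k : fieldType) (n : nat) (D : simplicial_complex n).

Lemma mnm_of_set2 (i j : 'I_n) :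
  i != j -> mnm_of_set [set i; j] = (U_(i) + U_(j))%MM.
Proof.
move=> ij; apply/mnmP => u; rewrite mnmDE !mnmE !inE.
rewrite ![u == _]eq_sym; case: (eqVneq i u) => [<-|] //=.
by rewrite eq_sym (negPf ij).
Qed.

(** Only the terms [u = i] and [u = j] contribute, since ['X_u] has to divide the squarefree
    monomial on [i] and [j]. *)
Lemma mcoeff_linear_mul (c : 'I_n -> k) (p : {mpoly k[n]}) (i j : 'I_n) :
  i != j ->
  ((\sum_u c u *: 'X_u) * p)@_(mnm_of_set [set i; j])
  = c i * p@_U_(j) + c j * p@_U_(i).
Proof.
move=> ij; rewrite mnm_of_set2 // mulr_suml raddf_sum /=.
rewrite (bigD1 i) // (bigD1 j) /=; last by rewrite eq_sym.
rewrite big1 ?addr0 => [|u /andP[ui uj]].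
  rewrite -!scalerAl !mcoeffZ ![_ * p]mulrC mcoeffMX.
  by rewrite [(U_(i) + _)%MM]addmC mcoeffMX.
rewrite -scalerAl mcoeffZ mcoeffM big1 ?mulr0 // => -[m1 m2] /= /eqP/mnmP/(_ u).
rewrite mcoeffX; case: eqP => [<-|_]; last by rewrite mul0r.
rewrite !mnmDE !mnmE eqxx !(eq_sym _ u) (negPf ui) (negPf uj).
by rewrite addSn.
Qed.

Lemma linear_formE (c : 'I_n -> k) :
  linear_form D c = SRproj D (\sum_u c u *: 'X_u).
Proof. by rewrite linear_sum; apply: eq_bigr => i _; rewrite linearZ. Qed.

Lemma face_coeff_eq (p q : {mpoly k[n]}) (F : {set 'I_n}) :
  F \in (D : {set _}) -> SRproj D p = SRproj D q ->
  p@_(mnm_of_set F) = q@_(mnm_of_set F).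
Proof.
move=> DF /SRproj_eqP/face_coeff0/(_ DF)/eqP.
by rewrite mcoeffB subr_eq0 => /eqP.
Qed.

(** Monomials of degree [j] span this component, and those not supported squarefree on a face vanish
    in the quotient. *)
Lemma grade_face (j : nat) : SRgrade k D j != 0%VS ->
  exists2 F : {set 'I_n}, F \in (D : {set _}) & #|F| = j.
Proof.
move=> nz; have [//|noF] := boolp.pselect (exists2 F : {set 'I_n},
  F \in (D : {set _}) & #|F| = j).
case/negP: nz; rewrite -subv0; apply/subvP => a /SRgradeP[p /dhomogP hp ->].
rewrite memv0; apply/eqP/SRproj_eq0P; rewrite [p]mpolyE big_seq.
apply: ideal_gen_sum => m /hp dm.
rewrite -mul_mpolyC; apply: ideal_genM; apply: defining_idealX => F DF.
apply/eqP => e; apply: noF; exists F => //.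
have {}dm : mdeg m = j := dm.
rewrite -dm e mdegE -sum1_card big_mkcond; apply: eq_bigr => i _.
by rewrite mnmE; case: (i \in F).
Qed.

(** Rank-nullity: the image lies in degree [i.+1] and, by injectivity, has the dimension of degree
    [i]. *)
Lemma linear_form_inj_surj (c : 'I_n -> k) (i : nat) :
    (\dim (SRgrade k D i.+1) <= \dim (SRgrade k D i))%N ->
    {in SRgrade k D i &, injective (fun a => linear_form D c * a)} ->
  forall b, b \in SRgrade k D i.+1 ->
    exists2 a, a \in SRgrade k D i & b = linear_form D c * a.
Proof.
move=> dim_le inj; pose f := linfun (GRing.mull_fun (linear_form D c) idfun).
have fE a : f a = linear_form D c * a by rewrite lfunE.
have ker0 : (SRgrade k D i :&: lker f)%VS = 0%VS.
  apply/eqP; rewrite -subv0; apply/subvP => a /memv_capP[Aa].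
  rewrite memv_ker fE memv0 -[X in _ == X](mulr0 (linear_form D c)).
  by move=> /eqP/inj ->; rewrite ?mem0v.
have /eqP im : (f @: SRgrade k D i)%VS == SRgrade k D i.+1.
  rewrite eqEdim limg_dim_eq // dim_le andbT.
  apply/subvP => _ /memv_imgP[_ /SRgradeP[p hp ->] ->].
  rewrite fE linear_formE -rmorphM; apply/SRgradeP.
  exists ((\sum_u c u *: 'X_u) * p) => //; rewrite -add1n dhomogM //.
  by apply: rpred_sum => u _; rewrite rpredZ // dhomogX; apply/eqP/mdeg1.
by move=> b; rewrite -im => /memv_imgP[a Aa ->]; exists a; rewrite ?fE.
Qed.

(** In the cycle relation each edge is weighted by the coefficients of [c] at the two opposite
    vertices. As x_s x_t has coefficient 1 on the edge st and 0 on the other three, a preimage would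
    give c_u c_v = 0. *)
Lemma linear_form_not_surjective (c : 'I_n -> k) (s t u v : 'I_n) :
    uniq [:: s; t; u; v] -> [set s; t; u; v] \in (D : {set _}) ->
    c u * c v != 0 ->
  ~ exists a, SRproj D ('X_s * 'X_t) = linear_form D c * a.
Proof.
rewrite /= !inE !negb_or => /and4P[/and3P[st su sv] /andP[tu tv] uv _] DF cuv [a].
rewrite -(SRreprK a) linear_formE -rmorphM /=; set p := SRrepr a => e.
(* Coefficients at faces do not depend on the representative, so they may be compared across [e]. *)
have edge i j : i != j -> [set i; j] \subset [set s; t; u; v] ->
    (mnm_of_set [set i; j] == (U_(s) + U_(t))%MM)%:R
      = c i * p@_U_(j) + c j * p@_U_(i).
  move=> ij sF; rewrite -(mcoeff_linear_mul c p) //.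
  rewrite -(face_coeff_eq _ _ _ (faces_closed DF sF) e).
  by rewrite -mpolyXD mcoeffX eq_sym.
have sub i j : i \in [set s; t; u; v] -> j \in [set s; t; u; v] ->
  [set i; j] \subset [set s; t; u; v].
  by move=> Fi Fj; apply/subsetP => w; rewrite in_set2 => /orP[]/eqP->.
have := edge s t st; have := edge t u tu; have := edge u v uv.
have := edge v s; rewrite [v == s]eq_sym => /(_ sv).
rewrite !sub ?inE ?eqxx ?orbT //.
rewrite -!mnm_of_set2 // !(inj_eq (@mnm_of_set_inj n)) eqxx.
(* Each edge other than st misses some vertex [w] of st. *)
have ne i j w : w \in [set s; t] -> w != i -> w != j ->
  ([set i; j] == [set s; t]) = false.
  move=> stw wi wj; apply/negP => /eqP/setP/(_ w).
  by rewrite stw !inE (negPf wi) (negPf wj).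
rewrite (ne v s t) ?(ne u v s) ?(ne t u s) ?inE ?eqxx ?orbT //; last first.
  by rewrite eq_sym.
move=> /(_ isT) evs /(_ isT) euv /(_ isT) etu /(_ isT) est.
(* The relation around the cycle s, t, u, v, applied to x_s x_t. *)
case/eqP: cuv.
transitivity (c u * c v * true%:R - c s * c v * false%:R
              + c s * c t * false%:R - c t * c u * false%:R).
  by rewrite mulr1n mulr0n; ring.
by rewrite est {1}etu {1}euv evs; ring.
Qed.

End SkeletonEdges.

Theorem corollary3p6 (k : fieldType) (char0 : [pchar k]%R =i pred0)
    (n : nat) (n_gt0 : 0 < n) (D : simplicial_complex n)
    (wlp1 : WLP_in_degree k D 1)
    (dim_le : \dim (SRgrade k D 2) <= \dim (SRgrade k D 1)) :
  top_socle_degree k D <= 3.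
Proof.
rewrite /top_socle_degree; case: ex_maxnP => j /grade_face[F DF <-] _.
rewrite leqNgt; apply/negP => /card_geqP[w [uw sw wF]].
case: w uw sw wF => [|s [|t [|u [|v [|]]]]] // uw _ wF.
have Dstuv : [set s; t; u; v] \in (D : {set _}).
  apply: faces_closed DF _; apply/subsetP => x.
  by rewrite !inE -!orbA => stuv; apply: wF; rewrite !inE.
have [P P0 wlp] := wlp1.
(* One nonzero value of this product makes [c] general enough for [wlp] and keeps [c u] and [c v]
   nonzero. *)
have [c] : exists c : 'I_n -> k, (P * ('X_u * 'X_v)).@[c] != 0%R.
  apply: mpoly_nonroot => //; rewrite mulf_neq0 // -mpolyXD.
  by apply: contraTneq isT => /mpolyP/(_ (U_(u) + U_(v))%MM)/eqP;
    rewrite mcoeffX mcoeff0 eqxx oner_eq0.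
rewrite !mevalM !mevalXU mulf_eq0 negb_or => /andP[Pc cuv].
apply: (linear_form_not_surjective k n D c s t u v) => //.
suff [a _ ->] : exists2 a, a \in SRgrade k D 1
    & SRproj D ('X_s * 'X_t) = (linear_form D c * a)%R by exists a.
have A2 : SRproj D ('X_s * 'X_t) \in SRgrade k D 2.
  apply/SRgradeP; exists ('X_s * 'X_t)%R => //.
  by rewrite -mpolyXD dhomogX /= mdegD !mdeg1.
by case: (wlp c Pc) => [inj|]; [exact: linear_form_inj_surj | exact].
Qed.
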